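(* Let $n,m\ge1$. There is no complete and non-compact parabolic self-expander for the mean curvature flow (MCF) $X:\Sigma^n\to\mathbb{R}^{n+m}$ such that $X(\Sigma)$ is contained in a ball of $\mathbb{R}^{n+m}$ (of any radius).
   Context: A complete isometric immersion $X:\Sigma^n\to\mathbb{R}^{n+m}$ of an $n$-dimensional Riemannian manifold is a $\lambda$-soliton for the MCF with respect to $\vec 0$ ($\lambda\in\mathbb{R}$) if $\vec H=-\lambda X^\perp$, where $\vec H$ is the mean curvature vector of $X$ (the trace of the second fundamental form, so $\vec H=\Delta^\Sigma X$) and $X^\perp$ is the component of the position vector $X$ normal to $\Sigma$. It is a self-expander if $\lambda<0$. A complete Riemannian manifold $M$ is parabolic if every continuous subharmonic function $u:M\to\mathbb{R}$ ($\Delta u\ge 0$ when $u\in C^2$) with $\sup_M u<\infty$ is constant. *)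

(* Defs.v *)
From HB Require Import structures.
From mathcomp Require Import all_boot all_order all_algebra.
From mathcomp Require Import all_classical all_reals all_analysis.

Set Implicit Arguments.
Unset Strict Implicit.
Unset Printing Implicit Defensive.

Import Order.TTheory GRing.Theory Num.Theory.
Import numFieldNormedType.Exports.
Local Open Scope classical_set_scope.
Local Open Scope ring_scope.

Section Euclidean.
Context {R : realType}.

(* The library norm on 'rV[R]_N is the sup norm, hence a separate Euclidean
   norm. *)
Definition enorm N (v : 'rV[R]_N) : R := Num.sqrt (\sum_a v 0 a ^+ 2).

Definition partial n (V : normedModType R) (i : 'I_n) (f : 'rV[R]_n -> V) :
  'rV[R]_n -> V := 'D_(delta_mx 0 i : 'rV[R]_n) f.

(* C^k on the open set U.  Differentiability is implied by the continuity of
   the partial derivatives, so requiring it does not change the class. *)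
Fixpoint Ck n (V : normedModType R) (k : nat) (U : set 'rV[R]_n)
    (f : 'rV[R]_n -> V) : Prop :=
  match k with
  | 0 => forall x, U x -> {for x, continuous f}
  | k'.+1 => (forall x, U x -> differentiable f x) /\
             (forall i, Ck k' U (partial i f))
  end.

Definition smooth n (V : normedModType R) (U : set 'rV[R]_n)
    (f : 'rV[R]_n -> V) : Prop := forall k, Ck k U f.

End Euclidean.

(* [cmap] and [cinv] are total functions whose values matter only on [cdom]
   and [cimg] respectively. *)
Record chart (R : realType) (n : nat) (M : topologicalType) := Chart {
  cdom : set M;
  cimg : set 'rV[R]_n;
  cmap : M -> 'rV[R]_n;
  cinv : 'rV[R]_n -> M;
  cdom_open : open cdom;
  cimg_open : open cimg;
  cmap_cimg : forall p, cdom p -> cimg (cmap p);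
  cinv_cdom : forall x, cimg x -> cdom (cinv x);
  cmapK : forall p, cdom p -> cinv (cmap p) = p;
  cinvK : forall x, cimg x -> cmap (cinv x) = x;
  cmap_continuous : forall p, cdom p -> {for p, continuous cmap};
  cinv_continuous : forall x, cimg x -> {for x, continuous cinv}
}.

Section Transition.
Context {R : realType} {n : nat} {M : topologicalType}.
Implicit Types c : chart R n M.

Definition overlap c c' : set 'rV[R]_n := cimg c `&` cinv c @^-1` cdom c'.

Definition transition c c' : 'rV[R]_n -> 'rV[R]_n := cmap c' \o cinv c.

End Transition.

(* The metric is given by its Gram matrices [metric c x] in the coordinates of
   each chart c.  The library Jacobian acts on row vectors on the right, so
   row i of ['J f x] is the i-th partial derivative of f at x. *)
Record riemannianManifold (R : realType) (n : nat) := RiemannianManifold {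
  carrier :> topologicalType;
  carrier_hausdorff : hausdorff_space carrier;
  carrier_second_countable : @second_countable carrier;
  atlas : set (chart R n carrier);
  chart_at : carrier -> chart R n carrier;
  chart_at_atlas : forall p, atlas (chart_at p);
  chart_at_cdom : forall p, cdom (chart_at p) p;
  transition_smooth : forall c c', atlas c -> atlas c' ->
    smooth (overlap c c') (transition c c');
  metric : chart R n carrier -> 'rV[R]_n -> 'M[R]_n;
  metric_smooth : forall c, atlas c -> smooth (cimg c) (metric c);
  metric_sym : forall c x, atlas c -> cimg c x -> (metric c x)^T = metric c x;
  metric_pos : forall c x, atlas c -> cimg c x ->
    forall v : 'rV[R]_n, v != 0 -> 0 < (v *m metric c x *m v^T) 0 0;
  metric_transition : forall c c' x, atlas c -> atlas c' -> overlap c c' x ->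
    metric c x = 'J (transition c c') x *m metric c' (transition c c' x)
                   *m ('J (transition c c') x)^T
}.

Section Riemannian.
Context {R : realType} {n : nat} (M : riemannianManifold R n).
Implicit Types (p q : M) (c : chart R n M) (gamma : R -> M).

(* Curves parametrized by [0, 1]; being defined on all of R, they have
   two-sided derivatives at the endpoints too. *)
Definition C1_curve gamma : Prop := forall t, 0 <= t <= 1 ->
  {for t, continuous gamma} /\
  forall c, atlas c -> cdom c (gamma t) ->
    (\forall s \near t, derivable (cmap c \o gamma) s 1) /\
    {for t, continuous (derive1 (cmap c \o gamma))}.

Definition speed gamma (t : R) : R :=
  let c := chart_at (gamma t) in
  let v := derive1 (cmap c \o gamma) t in
  Num.sqrt ((v *m metric c (cmap c (gamma t)) *m v^T) 0 0).

Definition curve_length gamma : \bar R :=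
  (\int[lebesgue_measure]_(t in `[0%R, 1%R]) (speed gamma t)%:E)%E.

(* [path_length p q l]: some piecewise C^1 path from p to q has length l. *)
Inductive path_length : M -> M -> \bar R -> Prop :=
| PathNil p : path_length p p 0%E
| PathCons gamma q l : C1_curve gamma -> path_length (gamma 1) q l ->
    path_length (gamma 0) q (curve_length gamma + l)%E.

(* Equal to +oo when p and q lie in different components. *)
Definition rdist p q : \bar R := ereal_inf [set l | path_length p q l].

Definition complete_manifold : Prop := forall u : nat -> M,
  (forall e : R, 0 < e -> exists N, forall k l, (N <= k)%N -> (N <= l)%N ->
     (rdist (u k) (u l) < e%:E)%E) ->
  exists p, forall e : R, 0 < e -> exists N, forall k, (N <= k)%N ->
     (rdist (u k) p < e%:E)%E.

Definition Ck_on (V : normedModType R) (k : nat) (D : set M) (f : M -> V) :=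
  forall c, atlas c -> Ck k (cimg c `&` cinv c @^-1` D) (f \o cinv c).

Definition smooth_map (V : normedModType R) (f : M -> V) : Prop :=
  forall k, Ck_on k setT f.

Definition christoffel c (x : 'rV[R]_n) (i j k : 'I_n) : R :=
  let g a b := fun y => metric c y a b in
  2^-1 * \sum_l invmx (metric c x) k l *
    (partial i (g j l) x + partial j (g i l) x - partial l (g i j) x).

Definition hessian c (f : 'rV[R]_n -> R) (x : 'rV[R]_n) (i j : 'I_n) : R :=
  partial i (partial j f) x - \sum_k christoffel c x i j k * partial k f x.

(* Laplace-Beltrami operator, as the metric trace of the covariant Hessian. *)
Definition laplacian (u : M -> R) p : R :=
  let c := chart_at p in
  let x := cmap c p in
  \sum_i \sum_j invmx (metric c x) i j * hessian c (u \o cinv c) x i j.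

Definition harmonic_on (D : set M) (h : M -> R) : Prop :=
  Ck_on 2 D h /\ forall p, D p -> laplacian h p = 0.

Definition frontier (D : set M) : set M := closure D `\` D°.

(* Continuous functions need no Laplacian, so subharmonicity is comparison
   with harmonic functions on relatively compact domains; for C^2 functions
   this is equivalent to 0 <= laplacian u.  Requiring a nonempty frontier only
   excludes the domain that is a whole compact component. *)
Definition subharmonic (u : M -> R) : Prop :=
  continuous u /\
  forall (D : set M) (h : M -> R),
    open D -> connected D -> compact (closure D) -> frontier D !=set0 ->
    {within closure D, continuous h} -> harmonic_on D h ->
    (forall p, frontier D p -> u p <= h p) ->
    forall p, D p -> u p <= h p.

Definition parabolic : Prop := forall u : M -> R,
  subharmonic u -> (exists B, forall p, u p <= B) ->
  forall p q, u p = u q.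

End Riemannian.

Section Immersion.
Context {R : realType} {n N : nat} {M : riemannianManifold R n}.
Variable X : M -> 'rV[R]_N.
Implicit Types (p : M) (c : chart R n M) (v : 'rV[R]_N).

Definition isometric_immersion : Prop :=
  smooth_map X /\
  forall c x, atlas c -> cimg c x ->
    let J := 'J (X \o cinv c) x in row_free J /\ J *m J^T = metric c x.

(* Matrix whose rows, the coordinate vectors, span the image of the tangent
   space at p. *)
Definition tangent p : 'M[R]_(n, N) :=
  let c := chart_at p in 'J (X \o cinv c) (cmap c p).

Definition normal_part p v : 'rV[R]_N :=
  let J := tangent p in v - v *m J^T *m invmx (J *m J^T) *m J.

Definition second_fundamental_form p (i j : 'I_n) : 'rV[R]_N :=
  let c := chart_at p in
  normal_part p (partial i (partial j (X \o cinv c)) (cmap c p)).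

Definition mean_curvature p : 'rV[R]_N :=
  let c := chart_at p in
  \sum_i \sum_j
    invmx (metric c (cmap c p)) i j *: second_fundamental_form p i j.

Definition mcf_soliton (lambda : R) : Prop :=
  forall p, mean_curvature p = - lambda *: normal_part p (X p).

Definition self_expander : Prop :=
  exists lambda, lambda < 0 /\ mcf_soliton lambda.

Definition contained_in_ball : Prop :=
  exists (x0 : 'rV[R]_N) (r : R), forall p, enorm (X p - x0) < r.

End Immersion.

(* Main.v *)
(* For a self-expander, |X|^2 has Laplacian
   2n + 2 <X, H> = 2n - 2 lambda |X^perp|^2 >= 2n > 0.  Positivity of the
   Laplacian makes |X|^2 subharmonic: if h is harmonic on D, then |X|^2 - h has
   no local maximum in D.  When the image lies in a ball, |X|^2 is bounded, so
   parabolicity makes it constant, which contradicts the strict inequality. *)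

Require Import Defs.
From mathcomp Require Import all_boot all_order all_algebra.
From mathcomp Require Import all_classical all_reals all_analysis.
From mathcomp Require Import ring lra.

Set Implicit Arguments.
Unset Strict Implicit.
Unset Printing Implicit Defensive.

Import Order.TTheory GRing.Theory Num.Theory.
Import numFieldNormedType.Exports.
Local Open Scope classical_set_scope.
Local Open Scope ring_scope.

(** * Locality and algebra of the classes [Ck] *)

Section CkCalculus.
Context {R : realType} {n : nat}.
Local Notation E := 'rV[R]_n.
Implicit Types U : set E.

(** The first-order expansion of [f] at [x] depends only on its germ, so it is also one for [g];
    [diff_unique] then identifies the differential of [g]. *)
Lemma near_eq_differentiable (V W : normedModType R) (f g : V -> W) (x : V) :
  (\forall y \near x, f y = g y) -> differentiable f x -> differentiable g x.
Proof.
move=> fg df; have fgx : f x = g x := nbhs_singleton fg.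
have [dfc dfE] := (diff_locallyP x f).1 df.
have dgE : g \o shift x = cst (g x) + 'd f x +o_ 0 id.
  apply/eqaddoP => _/posnumP[e].
  have /eqaddoP/(_ e%:num [gt0 of e%:num]) := dfE.
  apply: filter_app; near=> h.
  suff gfE : (g \o shift x) h = (f \o shift x) h.
    by rewrite /= in gfE *; rewrite !fctE /= in gfE *; rewrite gfE -fgx.
  rewrite /=; apply/esym; near: h.
  have /nbhs_ballP[d /= d0 xd] := fg.
  apply/nbhs_ballP; exists d => //= h hd; apply: xd.
  by move: hd; rewrite -!ball_normE /= sub0r opprD addrCA subrr addr0.
have dE := diff_unique dfc dgE.
by apply/diff_locallyP; rewrite dE.
Unshelve. all: by end_near. Qed.

Lemma near_eq_continuous (V W : topologicalType) (f g : V -> W) (x : V) :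
  (\forall y \near x, f y = g y) -> {for x, continuous f} ->
  {for x, continuous g}.
Proof.
move=> fg cf; have fgx : f x = g x := nbhs_singleton fg.
rewrite /prop_for /continuous_at -fgx; apply: cvg_trans cf.
exact: near_eq_cvg.
Qed.

Lemma near_open (T : topologicalType) (A : set T) (P : T -> Prop) (x : T) :
  open A -> A x -> (forall y, A y -> P y) -> \forall y \near x, P y.
Proof.
move=> oA Ax AP; have := open_nbhs_nbhs (conj oA Ax).
by apply: filterS => y; exact: AP.
Qed.

Lemma partial_near_eq (V : normedModType R) i (f g : E -> V) x :
  (\forall y \near x, f y = g y) -> partial i f x = partial i g x.
Proof. exact: near_eq_derive. Qed.

(** Formulas for partial derivatives hold only on [U], the functions being arbitrary outside it.
    Since [U] is open, agreement on [U] is agreement of germs at its points, which derivatives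
    preserve. *)
Lemma Ck_eq (V : normedModType R) k U (f g : E -> V) :
  open U -> (forall x, U x -> f x = g x) -> Ck k U f -> Ck k U g.
Proof.
move=> oU; elim: k f g => [|k IHk] f g fg /=.
  by move=> cf x Ux; apply: near_eq_continuous (cf x Ux); exact: near_open fg.
move=> [df cf]; split.
  by move=> x Ux; apply: near_eq_differentiable (df x Ux); exact: near_open fg.
move=> i; apply: IHk (cf i) => x Ux.
by apply: partial_near_eq; exact: near_open fg.
Qed.

Lemma sub_Ck (V : normedModType R) k U U' (f : E -> V) :
  U `<=` U' -> Ck k U' f -> Ck k U f.
Proof.
move=> UU'; elim: k f => [|k IHk] f /=; first by move=> cf x /UU'; exact: cf.
by move=> [df cf]; split=> [x /UU'|i]; [exact: df|exact/IHk/cf].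
Qed.

Lemma CkW (V : normedModType R) k U (f : E -> V) : Ck k.+1 U f -> Ck k U f.
Proof.
elim: k f => [|k IHk] f [df cf].
  by move=> x Ux; exact/differentiable_continuous/df.
by split=> // i; exact/IHk/cf.
Qed.

Lemma partial_coord N i (F : E -> 'rV[R]_N) a x :
  differentiable F x -> partial i (fun y => F y 0 a) x = partial i F x 0 a.
Proof.
by move=> dF; rewrite /partial derive_mx ?mxE//; exact: diff_derivable.
Qed.

Lemma Ck_coord N k U (F : E -> 'rV[R]_N) a :
  open U -> Ck k U F -> Ck k U (fun x => F x 0 a).
Proof.
move=> oU; elim: k F => [|k IHk] F /=.
  move=> cF x Ux; apply: (@continuous_comp _ _ _ F (fun M => M 0 a)).
    exact: cF.
  exact/differentiable_continuous/differentiable_coord.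
move=> [dF cF]; split.
  move=> x Ux; apply: (@differentiable_comp _ _ _ _ F (fun M => M 0 a)).
    exact: dF.
  exact: differentiable_coord.
move=> i; apply: Ck_eq (IHk _ (cF i)) => // x Ux.
by rewrite partial_coord//; exact: dF.
Qed.

Lemma CkD k U (f g : E -> R) :
  open U -> Ck k U f -> Ck k U g -> Ck k U (f + g).
Proof.
move=> oU; elim: k f g => [|k IHk] f g /=.
  by move=> cf cg x Ux; apply: continuousD; [exact: cf|exact: cg].
move=> [df cf] [dg cg]; split.
  by move=> x Ux; apply: differentiableD; [exact: df|exact: dg].
move=> i; apply: Ck_eq (IHk _ _ (cf i) (cg i)) => // x Ux.
by rewrite /partial deriveD //; apply: diff_derivable; [exact: df|exact: dg].
Qed.

Lemma CkB k U (f g : E -> R) :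
  open U -> Ck k U f -> Ck k U g -> Ck k U (f - g).
Proof.
move=> oU; elim: k f g => [|k IHk] f g /=.
  by move=> cf cg x Ux; apply: continuousB; [exact: cf|exact: cg].
move=> [df cf] [dg cg]; split.
  by move=> x Ux; apply: differentiableB; [exact: df|exact: dg].
move=> i; apply: Ck_eq (IHk _ _ (cf i) (cg i)) => // x Ux.
by rewrite /partial deriveB //; apply: diff_derivable; [exact: df|exact: dg].
Qed.

Lemma CkM k U (f g : E -> R) :
  open U -> Ck k U f -> Ck k U g -> Ck k U (f * g).
Proof.
move=> oU; elim: k f g => [|k IHk] f g.
  by move=> cf cg x Ux; apply: continuousM; [exact: cf|exact: cg].
(* The Leibniz rule pairs each undifferentiated factor with a derivative of class [Ck k], so the
   factors are lowered to order [k] as well. *)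
move=> cf cg; have cf0 := CkW cf; have cg0 := CkW cg.
case: cf cg => [df cf] [dg cg]; split.
  by move=> x Ux; apply: differentiableM; [exact: df|exact: dg].
move=> i; apply: Ck_eq (CkD oU (IHk _ _ cf0 (cg i)) (IHk _ _ cg0 (cf i))) => //.
move=> x Ux; rewrite /partial deriveM //; apply: diff_derivable.
  exact: df.
exact: dg.
Qed.

Lemma Ck_cst k U (r : R) : open U -> Ck k U (cst r : E -> R).
Proof.
move=> oU; elim: k r => [|k IHk] r /=; first by move=> x _; exact: cst_continuous.
split=> [x _|i]; first exact: differentiable_cst.
by apply: Ck_eq (IHk 0) => // x _; rewrite /partial derive_cst.
Qed.

Lemma Ck_sum N k U (f : 'I_N -> E -> R) :
  open U -> (forall a, Ck k U (f a)) -> Ck k U (\sum_a f a).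
Proof.
move=> oU cf; apply: big_ind => //; first exact: Ck_cst.
by move=> g h; exact: CkD.
Qed.

End CkCalculus.

(** * Directional derivatives: mean values, mixed derivatives, maxima *)

Section DirectionalDerivatives.
Context {R : realType} {V : normedModType R}.
Implicit Types (f : V -> R) (x u v : V).

Lemma exists_lt_both (a b : R) : 0 < a -> 0 < b ->
  exists h, [/\ 0 < h, h < a & h < b].
Proof.
move=> a0 b0; have m0 : 0 < Num.min a b by rewrite lt_min a0.
have ha : Num.min a b / 2 < Num.min a b by rewrite gtr_pMr// invf_lt1// ltr1n.
exists (Num.min a b / 2); split; first by rewrite divr_gt0.
  by rewrite (lt_le_trans ha)// ge_min lexx.
by rewrite (lt_le_trans ha)// ge_min lexx orbT.
Qed.

Lemma is_derive_line f x v t : derivable f (t *: v + x) v ->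
  is_derive t 1 (fun s : R => f (s *: v + x)) ('D_v f (t *: v + x)).
Proof.
move=> df; have E : (fun h : R => h^-1 *:
      (((fun s : R => f (s *: v + x)) \o shift t) (h *: (1 : R)) -
       f (t *: v + x))) =
    (fun h => h^-1 *: ((f \o shift (t *: v + x)) (h *: v) - f (t *: v + x))).
  by apply/funext => h /=; rewrite [_%:A]mulr1 scalerDl addrA.
by apply: DeriveDef; [rewrite /derivable E|rewrite /derive E].
Qed.

Lemma MVT_line f x v h : 0 < h ->
  (forall t, 0 <= t <= h -> derivable f (t *: v + x) v) ->
  exists2 t, 0 < t < h & f (h *: v + x) - f x = h * 'D_v f (t *: v + x).
Proof.
move=> h0 df.
have df' t : 0 <= t <= h ->
    is_derive t 1 (fun s : R => f (s *: v + x)) ('D_v f (t *: v + x)).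
  by move=> th; apply: is_derive_line; exact: df.
have [||t] := MVT (f := fun s : R => f (s *: v + x))
    (df := fun t => 'D_v f (t *: v + x)) h0.
- by move=> t; rewrite in_itv /= => /andP[? ?]; apply: df'; rewrite !ltW.
- apply: derivable_within_continuous => t; rewrite in_itv /= => th.
  exact: (@ex_derive _ _ _ _ _ _ _ (df' t th)).
rewrite in_itv /= => th E; exists t => //.
by rewrite mulrC -[h in RHS]subr0 -E scale0r add0r.
Qed.

(** The second difference is the increment over [[0, h]] of [phi], the difference of [f] across the
    side [h *: v]. The mean value theorem for [phi] yields a difference of ['D_u f] along [v], to
    which it applies again. *)
Lemma MVT_rectangle f x u v h : 0 < h ->
  (forall s t, 0 <= s <= h -> 0 <= t <= h ->
    derivable f (t *: v + (s *: u + x)) u /\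
    derivable ('D_u f) (t *: v + (s *: u + x)) v) ->
  exists s t, [/\ 0 < s < h, 0 < t < h &
    f (h *: v + (h *: u + x)) - f (h *: u + x) - f (h *: v + x) + f x =
    h * h * 'D_v ('D_u f) (t *: v + (s *: u + x))].
Proof.
move=> h0 df.
have h0h : 0 <= h <= h by rewrite lexx ltW.
have o0h : 0 <= (0 : R) <= h by rewrite lexx ltW.
pose phi s := f (s *: u + (h *: v + x)) - f (s *: u + x).
pose dphi s := 'D_u f (s *: u + (h *: v + x)) - 'D_u f (s *: u + x).
have dphiE s : 0 <= s <= h -> is_derive s 1 phi (dphi s).
  move=> sh; apply: is_deriveB; apply: is_derive_line.
    by rewrite addrCA; exact: (df s h sh h0h).1.
  by have := (df s 0 sh o0h).1; rewrite scale0r add0r.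
have [||s] := MVT (f := phi) (df := dphi) h0.
- by move=> s; rewrite in_itv /= => /andP[? ?]; apply: dphiE; rewrite !ltW.
- apply: derivable_within_continuous => s; rewrite in_itv /= => sh.
  exact: (@ex_derive _ _ _ _ _ _ _ (dphiE s sh)).
rewrite in_itv /= => sh phiE.
have sh' : 0 <= s <= h by case/andP: sh => ? ?; rewrite !ltW.
have [|t th tE] := @MVT_line ('D_u f) (s *: u + x) v h h0.
  by move=> t th; exact: (df s t sh' th).2.
exists s, t; split => //; rewrite -mulrA -tE.
move: phiE; rewrite /phi /dphi subr0 scale0r !add0r.
rewrite [s *: u + (h *: v + x)]addrCA [h *: u + (h *: v + x)]addrCA => phiE.
rewrite mulrC -phiE; ring.
Qed.

Lemma near_rectangle (P : V -> Prop) x u v : (\forall y \near x, P y) ->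
  exists2 e : R, 0 < e & forall s t, `|s| < e -> `|t| < e ->
    P (t *: v + (s *: u + x)).
Proof.
move=> /nbhs_ballP[d /= d0 xd].
have c0 : 0 < `|u| + `|v| + 1 by rewrite ltr_wpDl// addr_ge0.
(* The displacement has norm at most [|t| |v| + |s| |u|]; the extra 1 keeps the denominator positive
   when both directions vanish. *)
exists (d / (`|u| + `|v| + 1)); first by rewrite divr_gt0.
move=> s t sd td; apply: xd; rewrite -ball_normE /=.
rewrite -normrN opprB addrA addrK (le_lt_trans (ler_normD _ _))// !normrZ.
move: sd td; rewrite !ltr_pdivlMr// => sd td.
have := normr_ge0 u; have := normr_ge0 v.
have := normr_ge0 s; have := normr_ge0 t.
move: `|u| `|v| `|s| `|t| c0 sd td => a b c e c0 sd td e0 c1 b0 a0.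
nra.
Qed.

Lemma near_line (P : V -> Prop) x v : (\forall y \near x, P y) ->
  exists2 e : R, 0 < e & forall t, `|t| < e -> P (t *: v + x).
Proof.
move=> /(@near_rectangle _ _ 0 v)[e e0 eP]; exists e => // t te.
by have := eP 0 t; rewrite scaler0 add0r normr0; exact.
Qed.

(** Schwarz's theorem. The second difference over a small square is symmetric in [u] and [v], so by
    [MVT_rectangle] the two mixed derivatives take a common value at two points near [x]. Continuity
    excludes this if they differ at [x]. *)
Lemma derive_comm f x u v :
  (\forall y \near x, derivable f y u /\ derivable f y v) ->
  (\forall y \near x, derivable ('D_u f) y v /\ derivable ('D_v f) y u) ->
  {for x, continuous ('D_v ('D_u f))} ->
  {for x, continuous ('D_u ('D_v f))} ->
  'D_v ('D_u f) x = 'D_u ('D_v f) x.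
Proof.
move=> df ddf cuv cvu; apply: contrapT => /eqP neq.
(* Half the gap: a common value within [e] of both derivatives at [x] would make the gap smaller
   than itself. *)
pose e := `|'D_v ('D_u f) x - 'D_u ('D_v f) x| / 2.
have e0 : 0 < e by rewrite divr_gt0// normr_gt0 subr_eq0.
have /cvgrPdist_lt/(_ e e0) nuv := cuv.
have /cvgrPdist_lt/(_ e e0) nvu := cvu.
have [d1 d10 P1] := near_rectangle u v (filterI df ddf).
have [d2 d20 P2] := near_rectangle u v (filterI nuv nvu).
have [h [h0 hd1 hd2]] := exists_lt_both d10 d20.
have lth d t : h < d -> 0 <= t <= h -> `|t| < d.
  by move=> hd /andP[t0 th]; rewrite ger0_norm// (le_lt_trans th).
have [s1 [t1 [/andP[s10 s11] /andP[t10 t11] E1]]] : exists s t,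
  [/\ 0 < s < h, 0 < t < h &
    f (h *: v + (h *: u + x)) - f (h *: u + x) - f (h *: v + x) + f x =
    h * h * 'D_v ('D_u f) (t *: v + (s *: u + x))].
  apply: (MVT_rectangle h0) => s t sh th.
  have [[fu _] [fuv _]] := P1 s t (lth _ _ hd1 sh) (lth _ _ hd1 th).
  exact: conj fu fuv.
have [s2 [t2 [/andP[s20 s21] /andP[t20 t21] E2]]] : exists s t,
  [/\ 0 < s < h, 0 < t < h &
    f (h *: u + (h *: v + x)) - f (h *: v + x) - f (h *: u + x) + f x =
    h * h * 'D_u ('D_v f) (t *: u + (s *: v + x))].
  (* With [u] and [v] exchanged, [s] runs along [v] and [t] along [u], hence the swapped arguments
     of [P1]. *)
  apply: (MVT_rectangle h0) => s t sh th; rewrite [_ *: u + _]addrCA.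
  have [[_ fv] [_ fvu]] := P1 t s (lth _ _ hd1 th) (lth _ _ hd1 sh).
  exact: conj fv fvu.
have s1h : 0 <= s1 <= h by rewrite !ltW.
have t1h : 0 <= t1 <= h by rewrite !ltW.
have s2h : 0 <= s2 <= h by rewrite !ltW.
have t2h : 0 <= t2 <= h by rewrite !ltW.
rewrite (addrCA (h *: u) (h *: v)) in E2.
have E : 'D_v ('D_u f) (t1 *: v + (s1 *: u + x)) =
         'D_u ('D_v f) (t2 *: u + (s2 *: v + x)).
  apply: (@mulfI _ (h * h)); first by rewrite mulf_neq0// gt_eqF.
  have swap (a b c d : R) : a - b - c + d = a - c - b + d by ring.
  rewrite -E1 -E2; exact: swap.
have [H1 _] := P2 s1 t1 (lth _ _ hd2 s1h) (lth _ _ hd2 t1h).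
have [_] := P2 t2 s2 (lth _ _ hd2 t2h) (lth _ _ hd2 s2h).
rewrite (addrCA (s2 *: v)) -E => {E E1 E2} H2.
have tri (a b c : R) : `|a - c| < e -> `|b - c| < e -> `|a - b| < e + e.
  move=> ac bc; rewrite -(subrKA c) (le_lt_trans (ler_normD _ _))//.
  by rewrite ltrD// distrC.
have := tri _ _ _ H1 H2.
by rewrite -splitr ltxx.
Qed.

(** The first claim is Fermat's theorem on the line through [x]. If the second derivative were
    positive, ['D_v f] would be positive just beyond [x], and the mean value theorem would give a
    value above the maximum. *)
Lemma second_derivative_test f x v :
  (\forall y \near x, derivable f y v) -> derivable ('D_v f) x v ->
  (\forall y \near x, f y <= f x) ->
  'D_v f x = 0 /\ 'D_v ('D_v f) x <= 0.
Proof.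
move=> df ddf fmax.
have [e e0 eP] := near_line v (filterI df fmax).
have Df0 : 'D_v f x = 0.
  have D0 : is_derive (0 : R) 1 (fun s : R => f (s *: v + x)) 0.
    apply: (@derive1_at_max _ _ (- e) e); first by rewrite ge0_cp// ltW.
    - move=> t; rewrite in_itv /= -ltr_norml => te.
      exact: (@ex_derive _ _ _ _ _ _ _ (is_derive_line (eP t te).1)).
    - by rewrite in_itv /= oppr_lt0 e0.
    - move=> t; rewrite in_itv /= -ltr_norml => /eP[_].
      by rewrite scale0r add0r.
  have := @is_derive_line f x v 0; rewrite scale0r add0r => -[].
    exact: nbhs_singleton df.
  by move=> _ <-; rewrite derive_val.
split=> //; rewrite leNgt; apply/negP => D2.
(* The difference quotients of ['D_v f] converge to a positive limit, so they are eventually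
   positive. *)
have : \forall h \near 0^', 0 < h^-1 *: ('D_v f (h *: v + x) - 'D_v f x).
  by have /cvgr_gt := ddf; apply.
rewrite Df0 => /nbhs_ballP[d /= d0 dP].
have [h [h0 hd he]] := exists_lt_both d0 e0.
have [|t /andP[t0 th] fE] := @MVT_line f x v h h0.
  move=> t /andP[t0 th]; apply: (eP t _).1.
  by rewrite ger0_norm// (le_lt_trans th).
have : 0 < f (h *: v + x) - f x.
  rewrite fE mulr_gt0//.
  have := dP t; rewrite -ball_normE /= sub0r normrN gtr0_norm//.
  move=> /(_ (lt_trans th hd) (lt0r_neq0 t0)).
  by rewrite subr0 pmulr_rgt0// invr_gt0.
rewrite subr_gt0 ltNge; apply/negP/negPn.
by apply: (eP h _).2; rewrite gtr0_norm.
Qed.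

End DirectionalDerivatives.

(** * Euclidean inner product *)

Definition dot (R : realType) N (u v : 'rV[R]_N) : R := (u *m v^T) 0 0.

Section Dot.
Context {R : realType} {N : nat}.
Implicit Types u v w : 'rV[R]_N.

Lemma dotE u v : dot u v = \sum_k u 0 k * v 0 k.
Proof. by rewrite /dot mxE; apply: eq_bigr => k _; rewrite mxE. Qed.

Lemma dotC u v : dot u v = dot v u.
Proof. by rewrite !dotE; apply: eq_bigr => k _; rewrite mulrC. Qed.

Lemma dotDr u v w : dot u (v + w) = dot u v + dot u w.
Proof. by rewrite /dot linearD /= mulmxDr mxE. Qed.

Lemma dotNr u v : dot u (- v) = - dot u v.
Proof. by rewrite /dot linearN /= mulmxN mxE. Qed.

Lemma dotZr a u v : dot u (a *: v) = a * dot u v.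
Proof. by rewrite /dot linearZ /= -scalemxAr mxE. Qed.

Lemma dot_sumr (I : finType) u (f : I -> 'rV[R]_N) :
  dot u (\sum_i f i) = \sum_i dot u (f i).
Proof.
rewrite /dot linear_sum /= mulmx_sumr summxE.
by apply: eq_bigr.
Qed.

Lemma dot_ge0 u : 0 <= dot u u.
Proof. by rewrite dotE sumr_ge0// => k _; rewrite -expr2 sqr_ge0. Qed.

End Dot.

(** * Partial derivatives: product rule, symmetry, conditions at a maximum *)

Section PartialDerivatives.
Context {R : realType} {n : nat}.
Local Notation E := 'rV[R]_n.
Implicit Types (U : set E) (f : E -> R).

Lemma derive_partial f (v y : E) : differentiable f y ->
  'D_v f y = \sum_i v 0 i * partial i f y.
Proof.
move=> df; rewrite deriveE// {1}(row_sum_delta v) linear_sum.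
by apply: eq_bigr => i _; rewrite linearZ /partial deriveE.
Qed.

Lemma dot_fctE N (A B : E -> 'rV[R]_N) :
  (fun z => dot (A z) (B z)) = \sum_k (fun z => A z 0 k) * (fun z => B z 0 k).
Proof. by apply/funext => z; rewrite dotE fct_sumE. Qed.

Lemma differentiable_coord_comp N (A : E -> 'rV[R]_N) y k :
  differentiable A y -> differentiable (fun z => A z 0 k) y.
Proof.
move=> dA; apply: (@differentiable_comp _ _ _ _ A (fun M => M 0 k)) => //.
exact: differentiable_coord.
Qed.

Lemma differentiable_dot N (A B : E -> 'rV[R]_N) y :
  differentiable A y -> differentiable B y ->
  differentiable (fun z => dot (A z) (B z)) y.
Proof.
move=> dA dB; rewrite dot_fctE; apply: differentiable_sum => k.
by apply: differentiableM; exact: differentiable_coord_comp.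
Qed.

Lemma partial_dot N i (A B : E -> 'rV[R]_N) y :
  differentiable A y -> differentiable B y ->
  partial i (fun z => dot (A z) (B z)) y =
  dot (A y) (partial i B y) + dot (partial i A y) (B y).
Proof.
move=> dA dB; have dc (C : E -> 'rV[R]_N) k : differentiable C y ->
    derivable (fun z => C z 0 k) y (delta_mx 0 i).
  by move=> dC; apply: diff_derivable; exact: differentiable_coord_comp.
rewrite dot_fctE {1}/partial derive_sum; last first.
  by move=> k; apply: derivableM; exact: dc.
rewrite !dotE -big_split /=; apply: eq_bigr => k _.
rewrite deriveM; [|exact: dc..].
rewrite -!partial_coord// /partial; congr (_ + _); exact: mulrC.
Qed.

Lemma Ck_dot N k U (A B : E -> 'rV[R]_N) : open U ->
  Ck k U A -> Ck k U B -> Ck k U (fun z => dot (A z) (B z)).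
Proof.
move=> oU cA cB; rewrite dot_fctE; apply: Ck_sum => // a.
by apply: CkM => //; exact: Ck_coord.
Qed.

Lemma partialC f U x i j : open U -> U x -> Ck 2 U f ->
  partial i (partial j f) x = partial j (partial i f) x.
Proof.
move=> oU Ux [df cf].
apply: derive_comm.
- apply: near_open oU Ux _ => y Uy.
  by split; apply: diff_derivable; exact: df.
- apply: near_open oU Ux _ => y Uy.
  by split; apply: diff_derivable; [exact: (cf j).1|exact: (cf i).1].
- exact: (cf j).2.
- exact: (cf i).2.
Qed.

Lemma partial2_coord N (F : E -> 'rV[R]_N) U x i j a :
  open U -> U x -> Ck 2 U F ->
  partial i (partial j F) x 0 a = partial i (partial j (fun y => F y 0 a)) x.
Proof.
move=> oU Ux [dF cF]; rewrite -partial_coord; last exact: (cF j).1.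
apply: partial_near_eq; apply: near_open oU Ux _ => y Uy.
by rewrite partial_coord//; exact: dF.
Qed.

(** [derive_comm] rests on the mean value theorem and so is scalar; the vector case follows
    coordinate by coordinate. *)
Lemma partial_rVC N (F : E -> 'rV[R]_N) U x i j : open U -> U x -> Ck 2 U F ->
  partial i (partial j F) x = partial j (partial i F) x.
Proof.
move=> oU Ux cF; apply/rowP => a.
etransitivity; first exact: (partial2_coord i j a oU Ux cF).
etransitivity; last exact: esym (partial2_coord j i a oU Ux cF).
by apply: (partialC i j oU Ux); exact: Ck_coord.
Qed.

(** The Hessian form at [v] is the second derivative of [f] in direction [v], so the one-dimensional
    test applies to every [v]. *)
Lemma local_max_C2 f U x : open U -> U x -> Ck 2 U f ->
  (\forall y \near x, f y <= f x) ->
  (forall i, partial i f x = 0) /\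
  forall v : E, \sum_i \sum_j v 0 i * v 0 j * partial i (partial j f) x <= 0.
Proof.
move=> oU Ux [df cf] fmax.
(* The expansion in partials holds only on [U], which suffices for differentiating once more at
   [x]. *)
have DvE (v : E) : \forall y \near x, (\sum_j v 0 j *: partial j f) y = 'D_v f y.
  apply: near_open oU Ux _ => y Uy; rewrite fct_sumE derive_partial//.
  exact: df.
have dDv (v : E) : differentiable (\sum_j v 0 j *: partial j f) x.
  by apply: differentiable_sum => j; apply: differentiableZ; exact: (cf j).1.
have test (v : E) : 'D_v f x = 0 /\ 'D_v ('D_v f) x <= 0.
  apply: second_derivative_test fmax.
    by apply: near_open oU Ux _ => y Uy; apply: diff_derivable; exact: df.
  by apply: diff_derivable; exact: near_eq_differentiable (DvE v) (dDv v).
split=> [i|v]; first exact: (test _).1.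
have := (test v).2; congr (_ <= _).
rewrite -(near_eq_derive v (DvE v)) derive_partial//.
apply: eq_bigr => i _; rewrite /partial derive_sum; last first.
  by move=> j; apply/derivableZ/diff_derivable; exact: (cf j).1.
rewrite mulr_sumr; apply: eq_bigr => j _.
rewrite deriveZ; last by apply: diff_derivable; exact: (cf j).1.
exact: mulrA.
Qed.

End PartialDerivatives.

(** * Positive definite matrices and traces of negative semidefinite forms *)

Section PositiveDefinite.
Context {R : realType} {n : nat}.

Lemma posdef_unitmx (G : 'M[R]_n) :
  (forall v : 'rV[R]_n, v != 0 -> 0 < (v *m G *m v^T) 0 0) -> G \in unitmx.
Proof.
move=> Gpos; rewrite -row_free_unit -kermx_eq0; apply/rowV0P => v /sub_kermxP vG.
apply/eqP/negPn/negP => /Gpos; by rewrite vG mul0mx mxE ltxx.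
Qed.

(** [K *m K^T] is the sum of the rank-one matrices of the columns of [K], and each column
    contributes one value of the form [H]. *)
Lemma gram_contraction_le0 N (K : 'M[R]_(n, N)) (H : 'I_n -> 'I_n -> R) :
  (forall v : 'rV[R]_n, \sum_i \sum_j v 0 i * v 0 j * H i j <= 0) ->
  \sum_i \sum_j (K *m K^T) i j * H i j <= 0.
Proof.
move=> Hneg.
rewrite (_ : \sum_i _ = \sum_a \sum_i \sum_j K i a * K j a * H i j).
  apply: sumr_le0 => a _; have := Hneg (\row_i K i a).
  by under eq_bigr do under eq_bigr do rewrite !mxE.
rewrite [RHS]exchange_big /=; apply: eq_bigr => i _.
rewrite [RHS]exchange_big /=; apply: eq_bigr => j _.
by rewrite mxE mulr_suml; apply: eq_bigr => a _; rewrite mxE.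
Qed.

End PositiveDefinite.

(** * Local geometry of an isometric immersion *)

Section IsometricImmersion.
Context {R : realType} {n N : nat} {M : riemannianManifold R n}.
Variable X : M -> 'rV[R]_N.
Hypothesis immX : isometric_immersion X.

Lemma immersion_Ck k c : atlas c -> Ck k (cimg c) (X \o cinv c).
Proof. by move=> ac; apply: sub_Ck (immX.1 k c ac) => x ?; split. Qed.

Lemma immersion_diff c x : atlas c -> cimg c x ->
  differentiable (X \o cinv c) x.
Proof. by move=> ac; exact: (immersion_Ck 1 ac).1. Qed.

Section AtPoint.
Variables (c : chart R n M) (x : 'rV[R]_n).
Hypotheses (ac : atlas c) (cx : cimg c x).
Let oc : open (cimg c) := @cimg_open _ _ _ c.
Let F := X \o cinv c.
Let J := 'J F x.
Let Gi := invmx (metric c x).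
Let d i := partial i F x.
Let dd i j := partial i (partial j F) x.

Lemma row_jacobian y i : cimg c y -> row i ('J F y) = partial i F y.
Proof.
by move=> cy; rewrite /partial deriveEjacobian ?rowE//; exact: immersion_diff.
Qed.

Lemma metricE y i j : cimg c y ->
  metric c y i j = dot (partial i F y) (partial j F y).
Proof.
move=> cy; rewrite -(immX.2 c y ac cy).2 -!row_jacobian// dotE mxE.
by apply: eq_bigr => k _; rewrite !mxE.
Qed.

Lemma partial_metric i a b :
  partial i (fun y => metric c y a b) x = dot (d a) (dd i b) + dot (dd i a) (d b).
Proof.
have [_ cF] := immersion_Ck 2 ac.
rewrite (@partial_near_eq _ _ _ _ _ (fun y => dot (partial a F y) (partial b F y))).
  by rewrite partial_dot//; [exact: (cF a).1|exact: (cF b).1].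
by apply: near_open oc cx _ => y cy; exact: metricE.
Qed.

Lemma partial2_comm i j : dd i j = dd j i.
Proof. exact: partial_rVC oc cx (immersion_Ck 2 ac). Qed.

(** By [partial_metric] the three metric derivatives give six inner products. Symmetry of second
    derivatives cancels four of them and makes the other two equal, which absorbs the factor
    [2^-1]. *)
Lemma christoffelE i j k :
  christoffel c x i j k = \sum_l Gi k l * dot (dd i j) (d l).
Proof.
rewrite /christoffel mulr_sumr; apply: eq_bigr => l _.
rewrite !partial_metric; have ddC := partial2_comm; clearbody d dd.
rewrite (ddC j i) (ddC l j) (ddC l i) [dot (dd i l) _]dotC.
have half (g a b e : R) : 2^-1 * (g * (a + e + (b + e) - (b + a))) = g * e.
  by field.
exact: half.
Qed.

Lemma metric_unitmx : metric c x \in unitmx.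
Proof. by apply: posdef_unitmx => v v0; exact: metric_pos. Qed.

Lemma tr_invmx_metric : Gi^T = Gi.
Proof. by rewrite /Gi trmx_inv Defs.metric_sym. Qed.

Lemma gramE : J *m J^T = metric c x.
Proof. exact: (immX.2 c x ac cx).2. Qed.

(* Factoring the inverse metric through the Jacobian stands in for a spectral
   decomposition in the trace of a negative semidefinite Hessian. *)
Lemma invmx_metricE : Gi = (Gi *m J) *m (Gi *m J)^T.
Proof.
rewrite trmx_mul tr_invmx_metric mulmxA -(mulmxA Gi) gramE.
by rewrite mulVmx ?mul1mx// metric_unitmx.
Qed.

(* Gauss formula: the Levi-Civita connection is the tangential part of the
   Euclidean derivative. *)
Lemma christoffel_tangential i j :
  \sum_k christoffel c x i j k *: d k = dd i j *m J^T *m Gi *m J.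
Proof.
rewrite [RHS]mulmx_sum_row; apply: eq_bigr => k _.
rewrite row_jacobian// christoffelE; congr (_ *: _).
rewrite mxE; apply: eq_bigr => l _.
rewrite -{1}tr_invmx_metric mxE mulrC; congr (_ * _).
rewrite /d -row_jacobian// dotE mxE; apply: eq_bigr => a _.
by rewrite !mxE.
Qed.

(** The product rule gives [2 * metric c x i j] plus twice the inner product of [F x] with [dd i j].
    By the Gauss formula the Christoffel correction removes the tangential part of [dd i j], leaving
    the second fundamental form. *)
Lemma hessian_sqnorm i j :
  hessian c (fun y => dot (F y) (F y)) x i j =
  2 * metric c x i j + 2 * dot (F x) (dd i j - dd i j *m J^T *m Gi *m J).
Proof.
have [dF cF] := immersion_Ck 2 ac.
have dsq k y : cimg c y -> partial k (fun z => dot (F z) (F z)) y =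
    2 * dot (F y) (partial k F y).
  move=> cy; rewrite partial_dot; [|exact: dF..].
  by rewrite [in X in _ + X]dotC mulr2n mulrDl mul1r.
rewrite /hessian (@partial_near_eq _ _ _ _ _
    (2 \*o (fun y => dot (F y) (partial j F y)))); last first.
  by apply: near_open oc cx _ => y cy; exact: dsq.
have dfg : derivable (fun y => dot (F y) (partial j F y)) x (delta_mx 0 i).
  by apply/diff_derivable/differentiable_dot; [exact: dF|exact: (cF j).1].
rewrite {1}/partial deriveMl// -/(partial _ _ _) partial_dot; last first.
- exact: (cF j).1.
- exact: dF.
rewrite -christoffel_tangential dotDr dotNr dot_sumr metricE//.
(* The first-order terms are gathered into an inner product with the tangential vector of
   [christoffel_tangential]. *)
rewrite [\sum_k christoffel _ _ _ _ _ * _](_ : _ =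
    2 * \sum_k dot (F x) (christoffel c x i j k *: d k)); last first.
  by rewrite mulr_sumr; apply: eq_bigr => k _; rewrite dsq// dotZr mulrCA.
by rewrite /dd /d; ring.
Qed.

End AtPoint.

End IsometricImmersion.

(** * The Laplacian of the squared norm and the maximum principle *)

Section Laplacian.
Context {R : realType} {n N : nat} {M : riemannianManifold R n}.
Variable X : M -> 'rV[R]_N.
Hypothesis immX : isometric_immersion X.

Let cmap_at (p : M) : cimg (chart_at p) (cmap (chart_at p) p).
Proof. exact/cmap_cimg/chart_at_cdom. Qed.

Let cinv_at (p : M) : cinv (chart_at p) (cmap (chart_at p) p) = p.
Proof. exact/cmapK/chart_at_cdom. Qed.

Lemma laplacian_sqnorm p :
  laplacian (fun q => dot (X q) (X q)) p =
  2 * n%:R + 2 * dot (X p) (mean_curvature X p).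
Proof.
have ap := chart_at_atlas p; have cp := cmap_at p; have Xp := cinv_at p.
rewrite /laplacian /mean_curvature /second_fundamental_form /normal_part /tangent.
move: (chart_at p) ap cp Xp => c; move: (cmap c p) => x ac cx xp.
(* The normal projection is now written with the inverse metric, matching [hessian_sqnorm]. *)
rewrite (gramE immX ac cx).
under eq_bigr do under eq_bigr do rewrite (hessian_sqnorm immX ac cx) /= xp
  mulrDr mulrCA [in X in _ + X]mulrCA -dotZr.
under eq_bigr do rewrite big_split -!mulr_sumr -dot_sumr.
rewrite big_split -!mulr_sumr -dot_sumr; congr (2 * _ + _).
(* The metric term is the trace of the inverse metric times the metric, hence [n]; symmetry of the
   metric matches the index order. *)
rewrite -[RHS](mxtrace1 R n) -(mulVmx (metric_unitmx ac cx)).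
apply: eq_bigr => i _; rewrite mxE; apply: eq_bigr => j _; congr (_ * _).
by rewrite -{1}(Defs.metric_sym ac cx) mxE.
Qed.

(** The normal part [v - t] is orthogonal to the tangential part [t], so the inner product is the
    squared norm of [v - t]. *)
Lemma dot_normal_part_ge0 p v : 0 <= dot v (normal_part X p v).
Proof.
have := gramE immX (chart_at_atlas p) (cmap_at p).
have := metric_unitmx (chart_at_atlas p) (cmap_at p).
rewrite /normal_part /tangent => + GE; rewrite -GE.
move: ('J _ _) => J {GE} uG.
set t := v *m J^T *m invmx (J *m J^T) *m J.
have wJ : (v - t) *m J^T = 0.
  by rewrite mulmxBl /t -[_ *m J *m J^T]mulmxA mulmxKV ?subrr.
have tw : dot (v - t) t = 0.
  rewrite /dot /t !trmx_mul trmxK !mulmxA wJ.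
  by rewrite !mul0mx mxE.
by rewrite -[X in dot X _](subrK t) dotC dotDr tw addr0 dot_ge0.
Qed.

Lemma expander_laplacian_gt0 (lambda : R) p : (0 < n)%N -> lambda < 0 ->
  mcf_soliton X lambda -> 0 < laplacian (fun q => dot (X q) (X q)) p.
Proof.
move=> n0 l0 sX; rewrite laplacian_sqnorm sX dotZr.
have := dot_normal_part_ge0 p (X p); have : 0 < n%:R :> R by rewrite ltr0n.
move: (dot _ _) (n%:R) => a b; nra.
Qed.

Lemma open_chart_preimage (c : chart R n M) (D : set M) :
  open D -> open (cimg c `&` cinv c @^-1` D).
Proof.
move=> oD; rewrite openE => y [cy Dy]; apply: filterI.
  exact: open_nbhs_nbhs (conj (@cimg_open _ _ _ c) cy).
by apply: (cinv_continuous cy); exact: open_nbhs_nbhs.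
Qed.

(** At [q] the first partials of [u] and [h] agree, so their Christoffel terms cancel. The
    difference of Laplacians is then the coordinate Hessian of [u - h] at a maximum contracted with
    the inverse metric. *)
Lemma laplacian_le_at_max (D : set M) (u h : M -> R) q :
  open D -> D q -> Ck_on 2 D u -> Ck_on 2 D h ->
  (forall p, D p -> u p - h p <= u q - h q) -> laplacian u q <= laplacian h q.
Proof.
move=> oD Dq cu ch max_q.
have ac := chart_at_atlas q; have cx := cmap_at q; have xq := cinv_at q.
rewrite -subr_le0 /laplacian.
move: (chart_at q) ac cx xq => c; move: (cmap c q) => x ac cx xq.
have oU := @open_chart_preimage c D oD; have Ux : (cimg c `&` cinv c @^-1` D) x.
  by split=> //; rewrite /preimage /= xq.
have {}cu := cu c ac; have {}ch := ch c ac; have cw := CkB oU cu ch.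
have [|Dw0 D2w] := local_max_C2 oU Ux cw.
  apply: near_open oU Ux _ => y [_ Dy].
  by rewrite /GRing.sub_fun /= !fctE /= xq; exact: max_q.
have {cw} Dw i y : (cimg c `&` cinv c @^-1` D) y ->
    partial i ((u \o cinv c) - (h \o cinv c)) y =
    partial i (u \o cinv c) y - partial i (h \o cinv c) y.
  move=> Uy; rewrite /partial deriveB//; apply: diff_derivable.
    exact: cu.1.
  exact: ch.1.
have D2wE i j : partial i (partial j ((u \o cinv c) - (h \o cinv c))) x =
    partial i (partial j (u \o cinv c)) x - partial i (partial j (h \o cinv c)) x.
  rewrite (@partial_near_eq _ _ _ _ _
    (partial j (u \o cinv c) - partial j (h \o cinv c))).
    rewrite /partial deriveB//; apply: diff_derivable.
      exact: (cu.2 j).1.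
    exact: (ch.2 j).1.
  by apply: near_open oU Ux _ => y; exact: Dw.
have D1E k : partial k (u \o cinv c) x = partial k (h \o cinv c) x.
  by apply/eqP; rewrite -subr_eq0 -Dw// Dw0.
(* By [invmx_metricE] this matrix times its transpose is the inverse metric. *)
have := gram_contraction_le0 (invmx (metric c x) *m 'J (X \o cinv c) x) D2w.
rewrite -(invmx_metricE immX ac cx); congr (_ <= _).
rewrite -sumrB; apply: eq_bigr => i _; rewrite -sumrB; apply: eq_bigr => j _.
rewrite D2wE -mulrBr; congr (_ * _); rewrite /hessian.
under [in RHS]eq_bigr do rewrite D1E.
by rewrite opprB addrA subrK.
Qed.

(** [u - h] attains its maximum on the compact closure of [D]. A maximum inside [D] would force a
    positive Laplacian below zero, so it lies on the frontier, where [u <= h]. *)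
Lemma laplacian_gt0_subharmonic (u : M -> R) : continuous u ->
  Ck_on 2 setT u -> (forall p, 0 < laplacian u p) -> subharmonic u.
Proof.
move=> uC u2 upos; split=> // D h oD _ cD _ hC [h2 hharm] uh p Dp.
have [||q] := @compact_EVT_max _ _ (fun p => u p - h p) (closure D) _ cD.
- by exists p; exact: subset_closure.
(* [h] is continuous only relative to the closure, so both functions are viewed on that subspace. *)
- move=> y; apply: (@continuousB _ _ _ (u : subspace _ -> R) (h : subspace _ -> R)).
    exact: (continuous_subspaceT uC).
  exact: hC.
rewrite inE => cDq qmax.
have {}qmax y : D y -> u y - h y <= u q - h q.
  by move=> Dy; apply: qmax; rewrite inE; exact: subset_closure.
have [Dq|Dq] := pselect (D q).
  have : laplacian u q <= laplacian h q.
    apply: laplacian_le_at_max oD Dq _ h2 qmax.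
    by move=> c ac; apply: sub_Ck (u2 c ac) => x [].
  by rewrite (hharm q Dq) leNgt upos.
(* As [D] is open it equals its interior, so a point of the closure outside [D] is a frontier
   point. *)
have uhq : u q <= h q by apply: uh; split=> //; rewrite ((interior_id D).1 oD).
have := qmax p Dp; move: uhq; lra.
Qed.

(** Smoothness of [X] is stated through charts only; near [p], [X] factors as its chart expression
    after [cmap]. *)
Lemma immersion_continuous : continuous X.
Proof.
move=> p; have ac := chart_at_atlas p; have cx := cmap_at p.
have dp := chart_at_cdom p; move: (chart_at p) ac cx dp => c ac cx dp.
apply: (@near_eq_continuous _ _ ((X \o cinv c) \o cmap c)).
  by apply: near_open (@cdom_open _ _ _ c) dp _ => q dq; rewrite /= cmapK.
apply: continuous_comp; first exact: cmap_continuous.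
exact/differentiable_continuous/immersion_diff.
Qed.

Lemma sqnorm_continuous : continuous (fun p => dot (X p) (X p)).
Proof.
move=> p; apply: (@continuous_comp _ _ _ X (fun v => dot v v)).
  exact: immersion_continuous.
by apply: differentiable_continuous; exact: differentiable_dot.
Qed.

Lemma ball_sqnorm_le (v x0 : 'rV[R]_N) r : enorm (v - x0) < r ->
  dot v v <= 2 * r ^+ 2 + 2 * dot x0 x0.
Proof.
move=> vr; have v0 : 0 <= enorm (v - x0) := sqrtr_ge0 _.
have r0 : 0 <= r := ltW (le_lt_trans v0 vr).
have vr2 : enorm (v - x0) ^+ 2 <= r ^+ 2 by rewrite ler_sqr ?nnegrE// ltW.
have e2 : enorm (v - x0) ^+ 2 = \sum_a (v - x0) 0 a ^+ 2.
  by rewrite sqr_sqrtr// sumr_ge0// => a _; exact: sqr_ge0.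
apply: (@le_trans _ _ (2 * enorm (v - x0) ^+ 2 + 2 * dot x0 x0)); last first.
  by rewrite lerD2r ler_pM2l.
rewrite e2 !dotE !mulr_sumr -big_split /=; apply: ler_sum => a _.
(* In each coordinate, [2 (v - x0)^2 + 2 x0^2 - v^2 = (v - 2 x0)^2]. *)
rewrite !mxE -subr_ge0.
have := sqr_ge0 (v 0 a - x0 0 a - x0 0 a); congr (0 <= _); ring.
Qed.

Lemma laplacian_cst (u : M -> R) (b : R) p :
  (forall q, u q = b) -> laplacian u p = 0.
Proof.
move=> /funext ->; apply: big1 => i _; apply: big1 => j _.
have partial_cst k : partial k (cst b \o cinv (chart_at p)) = cst 0.
  by apply/funext => y; exact: derive_cst.
rewrite /hessian partial_cst big1 ?subr0; last first.
  by move=> k _; rewrite partial_cst; exact: mulr0.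
by rewrite /partial derive_cst mulr0.
Qed.

End Laplacian.

Theorem theorem6p3 (R : realType) (n m : nat) (hn : (1 <= n)%N) (hm : (1 <= m)%N) :
  ~ exists (Sigma : riemannianManifold R n) (X : Sigma -> 'rV[R]_(n + m)),
      complete_manifold Sigma /\
      ~ compact [set: Sigma] /\
      parabolic Sigma /\
      isometric_immersion X /\
      self_expander X /\
      contained_in_ball X.
Proof.
move=> [M [X [_ [ncM [parM [immX [[lambda [l0 sX]] [x0 [r ballX]]]]]]]]].
pose u p := dot (X p) (X p).
have upos p : 0 < laplacian u p := expander_laplacian_gt0 immX p hn l0 sX.
have u2 : Ck_on 2 setT u.
  move=> c ac; apply: (@sub_Ck _ _ _ _ _ (cimg c)) => [x []//|].
  by apply: Ck_dot; [exact: cimg_open|exact: immersion_Ck..].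
have subu := laplacian_gt0_subharmonic immX (sqnorm_continuous immX) u2 upos.
have bndu : exists B, forall p, u p <= B.
  by exists (2 * r ^+ 2 + 2 * dot x0 x0) => p; exact: ball_sqnorm_le (ballX p).
(* The contradiction is read off at a point. An empty manifold would be compact, so non-compactness
   supplies one. *)
have [[p _]|/set0P/negP/negPn/eqP M0] := pselect ([set: M] !=set0); last first.
  by apply: ncM; rewrite M0; exact: compact0.
(* Parabolicity makes [u] constant, so its Laplacian vanishes at [p], against [upos]. *)
have := upos p; rewrite (@laplacian_cst _ _ _ _ (u p)) ?ltxx// => q.
exact: parM subu bndu q p.
Qed.
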